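(* For integers $\ell,n\ge0$ let $B(1;2,3,3;\ell,n)$ be the number of partitions $\pi=(\pi_1,\dots,\pi_\ell)$ of $n$ with exactly $\ell$ parts such that (i) no odd part is repeated; (ii) $\pi_i\ge \pi_{i+2}+2$ for $1\le i\le \ell-2$, with strict inequality if $\pi_i$ is even; (iii) at most $2$ parts are less than or equal to $2$. Then, for $|q|<1$, \[\sum_{\ell,n\ge0}B(1;2,3,3;\ell,n)\,x^\ell q^n=\sum_{N_1\ge N_2\ge 0}\frac{q^{2(N_1^2+N_2^2)}\,(-xq^{1+2N_2};q^2)_\infty\, x^{N_1+N_2}}{(q^2;q^2)_{N_1-N_2}\,(q^2;q^2)_{N_2}}.\]
   Context: $(a;q)_\infty=\prod_{i\ge0}(1-aq^i)$ and $(a;q)_n=(a;q)_\infty/(aq^n;q)_\infty$. *)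

(* Defs.v *)
From mathcomp Require Import all_boot.

Definition is_partition (l n : nat) (s : seq nat) : bool :=
  [&& size s == l, sumn s == n, all (fun p => 0 < p) s & sorted geq s].

(* (i) no odd part is repeated (only values occurring in s can repeat). *)
Definition cond_i (s : seq nat) : bool :=
  all (fun k => odd k ==> (count_mem k s <= 1)) s.

Definition cond_ii (s : seq nat) : bool :=
  all (fun i => (nth 0 s (i + 2) + 2 <= nth 0 s i) &&
                (~~ odd (nth 0 s i) ==> (nth 0 s (i + 2) + 2 < nth 0 s i)))
      (iota 0 (size s - 2)).

Definition cond_iii (s : seq nat) : bool :=
  count (fun p => p <= 2) s <= 2.

(* B(1;2,3,3;l,n).  Every part of a partition of n is <= n, so parts can be
   taken in 'I_(n.+1); distinct tuples = distinct partitions. *)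
Definition B (l n : nat) : nat :=
  #|[set t : l.-tuple 'I_n.+1 |
       [&& is_partition l n (map val t), cond_i (map val t),
           cond_ii (map val t) & cond_iii (map val t)]]|.

From Stdlib Require Import Reals.
From Coquelicot Require Import Coquelicot.

Fixpoint qpoch (a q : C) (n : nat) : C :=
  match n with
  | O => 1%C
  | S m => (qpoch a q m * (1 - a * Cpow q m))%C
  end.

Definition qpoch_inf (a q : C) : C :=
  @lim (CompleteNormedModule.CompleteSpace _ C_CompleteNormedModule)
       (filtermap (qpoch a q) eventually).

Definition rhs_term (x q : C) (N1 N2 : nat) : C :=
  (Cpow q (2 * (N1 * N1 + N2 * N2))
   * qpoch_inf (- x * Cpow q (1 + 2 * N2)) (q * q)
   * Cpow x (N1 + N2)
   / (qpoch (q * q) (q * q) (N1 - N2) * qpoch (q * q) (q * q) N2))%C.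

(* Coefficient of q^n on the left: sum_{l} B(l,n) x^l (B(l,n) = 0 for l > n). *)
Definition lhs_coef (x : C) (n : nat) : C :=
  sum_n (fun l => (RtoC (INR (B l n)) * Cpow x l)%C) n.

(* Main.v *)
(** Condition (ii) says that at most two parts lie in each window [2m, 2m+2].
    So if G_j(x) counts the partitions with at most j parts <= 2, removing the
    parts 1 and 2 and subtracting 2 from all the others gives, with y = x q^2,
      G_0(x) = G_2(y),   G_1(x) = (1 + xq) G_2(y) + y G_1(y),
      G_2(x) = (1 + xq) G_2(y) + y (1 + xq) G_1(y) + y^2 G_0(y).
    Let S(a,b,c) be the double sum of the theorem with an extra factor
    q^(a(N_1-N_2) + b N_2) and with c added to the exponent of q in the infinite
    product. Then
      S(a,b,c) - S(a+2,b,c) = x q^(2+a) S(a+4,b+4,c),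
      S(a,b,c) - S(a,b+2,c) = x^2 q^(4+b) S(a+4,b+8,c+2),
      S(a,b,c) - S(a,b,c+2) = x q^(1+c) S(a,b+2,c+2),
    and x -> x q^2 turns S(a,b,c) into S(a+2,b+4,c+2). It follows that
      H_0 = S(2,4,2),  H_1 = S(2,2,0) + x q^2 S(4,6,2),  H_2 = S(0,0,0)
    satisfy the same system. Iterating it N times from the constant function 1
    gives the generating function of the partitions with parts at most 2N, and
    this converges to H_2 because the H_j are 1 + O(x) at x = 0. *)
Require Import Defs.
From Stdlib Require Import Reals Lra Lia FunctionalExtensionality.
From Coquelicot Require Import Coquelicot.
From HB Require Import structures.
From mathcomp Require Import ssreflect.

Local Open Scope R_scope.

(** * Limits of complex sequences *)

(** Convergence is phrased through the real distances, so that squeezing and limit arithmetic for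
    real sequences apply. *)
Definition Clim (u : nat -> C) (l : C) : Prop :=
  is_lim_seq (fun n => Cmod (u n - l)) 0.

Lemma filterlim_Clim (u : nat -> C) (l : C) :
  filterlim u eventually (@locally C_UniformSpace l) <-> Clim u l.
Proof.
split=> [/(@filterlim_locally_ball_norm _ _ C_NormedModule) H|/is_lim_seq_spec H].
- apply/is_lim_seq_spec => eps; have := H eps; apply: filter_imp => n.
  by rewrite Rminus_0_r Rabs_pos_eq //; apply: Cmod_ge_0.
- apply/(@filterlim_locally_ball_norm _ _ C_NormedModule) => eps.
  have := H eps; apply: filter_imp => n.
  by rewrite Rminus_0_r Rabs_pos_eq //; apply: Cmod_ge_0.
Qed.

Lemma is_series_Clim (a : nat -> C) (l : C) : is_series a l <-> Clim (sum_n a) l.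
Proof. exact: filterlim_Clim. Qed.

Lemma Clim_le (u : nat -> C) (l : C) (v : nat -> R) :
  (forall n, Cmod (u n - l) <= v n) -> is_lim_seq v 0 -> Clim u l.
Proof.
move=> H Hv; apply: (is_lim_seq_le_le (fun _ => 0) _ v) => //.
- by move=> n; split=> //; apply: Cmod_ge_0.
- exact: is_lim_seq_const.
Qed.

Lemma Clim_unique (u : nat -> C) (l m : C) : Clim u l -> Clim u m -> l = m.
Proof.
move=> H1 H2.
have H0 := is_lim_seq_plus' _ _ _ _ H1 H2; rewrite Rplus_0_l in H0.
have h : Cmod (l - m) <= 0.
  apply: (is_lim_seq_le (fun _ => Cmod (l - m)) _ (Cmod (l - m)) 0 _
    (is_lim_seq_const _) H0) => n.
  have -> : (l - m = (u n - m) - (u n - l))%C by ring.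
  apply: Rle_trans (Cmod_triangle _ _) _.
  by rewrite Cmod_opp Rplus_comm; right.
have /Cmod_eq_0 e : Cmod (l - m) = 0 by have := Cmod_ge_0 (l - m); lra.
have -> : (l = (l - m) + m)%C by ring.
by rewrite e Cplus_0_l.
Qed.

Lemma Clim_dist (u : nat -> C) (l c : C) (M : R) :
  Clim u l -> (forall n, Cmod (u n - c) <= M) -> Cmod (l - c) <= M.
Proof.
move=> Hu HM.
have H0 : is_lim_seq (fun n => M + Cmod (u n - l)) (M + 0).
  by apply: is_lim_seq_plus' => //; apply: is_lim_seq_const.
have := is_lim_seq_le (fun _ => Cmod (l - c)) _ (Cmod (l - c)) (M + 0) _
   (is_lim_seq_const _) H0.
rewrite /= Rplus_0_r; apply=> n.
have -> : (l - c = (u n - c) - (u n - l))%C by ring.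
apply: Rle_trans (Cmod_triangle _ _) _.
by rewrite Cmod_opp; apply: Rplus_le_compat_r.
Qed.

Lemma Clim_scal (u : nat -> C) (l k : C) :
  Clim u l -> Clim (fun n => (k * u n)%C) (k * l)%C.
Proof.
move=> H; apply: (Clim_le _ _ (fun n => Cmod k * Cmod (u n - l))).
- move=> n; rewrite -Cmod_mult; right; congr Cmod; ring.
- have := is_lim_seq_scal_l _ (Cmod k) _ H; by rewrite /= Rmult_0_r.
Qed.

Lemma Clim_S (u : nat -> C) (l : C) : Clim (fun n => u (S n)) l <-> Clim u l.
Proof. by rewrite /Clim -(is_lim_seq_incr_1 (fun n => Cmod (u n - l))). Qed.

Lemma Clim_ext (u v : nat -> C) (l : C) :
  (forall n, u n = v n) -> Clim u l -> Clim v l.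
Proof. by move=> e; apply: is_lim_seq_ext => n; rewrite e. Qed.

(** Written with the same filter as [qpoch_inf], which is therefore an instance of it by
    unfolding. *)
Definition Cseq_lim (u : nat -> C) : C :=
  @lim (CompleteNormedModule.CompleteSpace _ C_CompleteNormedModule)
       (filtermap u eventually).

(** [lim] is a total function, so convergence must be supplied: a limit [l] makes the filter Cauchy,
    and completeness does the rest. *)
Lemma Cseq_limP (u : nat -> C) (l : C) : Clim u l -> Clim u (Cseq_lim u).
Proof.
move=> /filterlim_Clim H; apply/filterlim_Clim.
apply/filterlim_locally => eps.
apply: (@complete_cauchy (CompleteNormedModule.CompleteSpace _ C_CompleteNormedModule)
  (filtermap u eventually) _ _ eps).
by move=> e; exists l; move/filterlim_locally: H => /(_ e).
Qed.

(** * Infinite products *)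

Lemma exp_ge1 (u : R) : 0 <= u -> 1 <= exp u.
Proof. by move=> hu; have := exp_ineq1_le u; lra. Qed.

Lemma exp_sub1_le (u : R) : 0 <= u -> exp u - 1 <= u * exp u.
Proof.
move=> hu; have h := exp_ineq1_le (- u); have e0 := exp_pos u.
have e1 : exp (- u) * exp u = 1 by rewrite -exp_plus Rplus_opp_l exp_0.
nra.
Qed.

Lemma exp_le_mono (u v : R) : u <= v -> exp u <= exp v.
Proof. by case=> [/exp_increasing|->]; [left | right]. Qed.

Lemma pow_unit (r : R) (n : nat) : 0 <= r <= 1 -> 0 <= r ^ n <= 1.
Proof.
move=> hr; split; first by apply: pow_le; lra.
by rewrite -(pow1 n); apply: pow_incr.
Qed.

(** The exponent is the sum of [|a| |Q|^i] over [i < n] in closed form. Keeping this exact sum lets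
    the induction close: each new factor costs [1 + t <= exp t] with [t = |a| |Q|^n]. *)
Lemma qpoch_dist1_partial (a Q : C) (n : nat) : Cmod Q < 1 ->
  Cmod (qpoch a Q n - 1) <=
  exp (Cmod a * ((1 - Cmod Q ^ n) / (1 - Cmod Q))) - 1.
Proof.
move=> hQ; elim: n => [|n IH] /=.
  have -> : (1 - 1 = 0)%C by ring.
  by rewrite Cmod_0 Rminus_diag /Rdiv Rmult_0_l Rmult_0_r exp_0; lra.
set r := Cmod Q in hQ IH *; set E := exp _ in IH.
have hr : 0 <= r ^ n by apply: pow_le; apply: Cmod_ge_0.
have -> : Cmod a * ((1 - r * r ^ n) / (1 - r)) =
  Cmod a * ((1 - r ^ n) / (1 - r)) + Cmod a * r ^ n by field; lra.
rewrite exp_plus -/E.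
have -> : (qpoch a Q n * (1 - a * Q ^ n) - 1 =
  (qpoch a Q n - 1) - (qpoch a Q n - 1 + 1) * (a * Q ^ n))%C by ring.
apply: Rle_trans (Cmod_triangle _ _) _; rewrite Cmod_opp !Cmod_mult Cmod_pow -/r.
have h1 := Cmod_triangle (qpoch a Q n - 1) 1; rewrite Cmod_1 in h1.
have h2 : 0 <= Cmod a * r ^ n by apply: Rmult_le_pos => //; apply: Cmod_ge_0.
have h3 := exp_ineq1_le (Cmod a * r ^ n); have h4 : 0 < E := exp_pos _.
move: h1 h2 h3 IH; set A := Cmod (_ + 1); set B := Cmod (_ - 1); set F := exp _.
set t := Cmod a * _ => h1 h2 h3 IH; nra.
Qed.

Lemma qpoch_dist1 (a Q : C) (n : nat) : Cmod Q < 1 ->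
  Cmod (qpoch a Q n - 1) <= exp (Cmod a / (1 - Cmod Q)) - 1.
Proof.
move=> hQ; apply: Rle_trans (qpoch_dist1_partial a Q n hQ) _.
apply: Rplus_le_compat_r; apply: exp_le_mono.
apply: Rmult_le_compat_l; first exact: Cmod_ge_0.
rewrite -[X in _ <= X]Rmult_1_l; apply: Rmult_le_compat_r.
  by left; apply: Rinv_0_lt_compat; lra.
have : 0 <= Cmod Q ^ n by apply: pow_le; apply: Cmod_ge_0.
lra.
Qed.

Lemma Cmod_le_dist1 (z : C) (M : R) : Cmod (z - 1) <= M - 1 -> Cmod z <= M.
Proof.
move=> h; have -> : (z = (z - 1) + 1)%C by ring.
by apply: Rle_trans (Cmod_triangle _ _) _; rewrite Cmod_1; lra.
Qed.

Lemma sum_n_telescope (u : nat -> C) (n : nat) :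
  sum_n (fun k => u (S k) - u k)%C n = (u (S n) - u 0%nat)%C.
Proof.
elim: n => [|n IH]; first by rewrite sum_O.
rewrite sum_Sn IH /plus /=; ring.
Qed.

(** The increments of the partial products are dominated by a geometric series, so the telescoping
    series converges absolutely. *)
Lemma qpoch_infP (a Q : C) : Cmod Q < 1 -> Clim (qpoch a Q) (qpoch_inf a Q).
Proof.
move=> hQ; set K := exp (Cmod a / (1 - Cmod Q)).
have [l hl] : ex_series (fun k => qpoch a Q (S k) - qpoch a Q k)%C.
  apply: (@ex_series_le _ C_CompleteNormedModule _
           (fun k => (K * Cmod a) * Cmod Q ^ k)).
  - move=> n; change (Cmod (qpoch a Q (S n) - qpoch a Q n)%C <= K * Cmod a * Cmod Q ^ n).
    have -> : (qpoch a Q (S n) - qpoch a Q n = - (qpoch a Q n * (a * Q ^ n)))%C.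
      by simpl; ring.
    rewrite Cmod_opp !Cmod_mult Cmod_pow Rmult_assoc; apply: Rmult_le_compat_r.
      by apply: Rmult_le_pos; [apply: Cmod_ge_0|apply: pow_le; apply: Cmod_ge_0].
    by apply: Cmod_le_dist1; apply: qpoch_dist1.
  - apply: ex_series_scal_l; exists (/ (1 - Cmod Q)); apply: is_series_geom.
    by rewrite Rabs_pos_eq //; apply: Cmod_ge_0.
(* The telescoping sum starts from the empty product 1, hence the limit [l + 1]. *)
apply: (Cseq_limP _ (l + 1)%C); apply/Clim_S.
move/is_series_Clim: hl; apply: is_lim_seq_ext => n.
rewrite sum_n_telescope /=; congr Cmod; ring.
Qed.

Lemma qpoch_inf_dist1 (a Q : C) : Cmod Q < 1 ->
  Cmod (qpoch_inf a Q - 1) <= exp (Cmod a / (1 - Cmod Q)) - 1.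
Proof.
move=> hQ; apply: (Clim_dist _ _ _ _ (qpoch_infP a Q hQ)) => n.
exact: qpoch_dist1.
Qed.

(** The definition splits off the last factor; splitting off the first one gives the recurrence of
    the infinite product. *)
Lemma qpochS (a Q : C) (n : nat) :
  qpoch a Q (S n) = ((1 - a) * qpoch (a * Q) Q n)%C.
Proof.
elim: n => [|n IH]; first by rewrite /=; ring.
change (qpoch a Q (S n) * (1 - a * Q ^ S n) =
        (1 - a) * (qpoch (a * Q) Q n * (1 - a * Q * Q ^ n)))%C.
rewrite IH Cpow_S; ring.
Qed.

Lemma qpoch_inf_rec (a Q : C) : Cmod Q < 1 ->
  qpoch_inf a Q = ((1 - a) * qpoch_inf (a * Q) Q)%C.
Proof.
move=> hQ; apply: (Clim_unique (fun n => qpoch a Q (S n))).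
  by apply/Clim_S; apply: qpoch_infP.
apply: (Clim_ext _ _ _ (fun n => Logic.eq_sym (qpochS a Q n))).
by apply: Clim_scal; apply: qpoch_infP.
Qed.

Lemma Cmod_1_sub_pow (Q : C) (n : nat) : Cmod Q < 1 ->
  1 - Cmod Q <= Cmod (1 - Q * Q ^ n).
Proof.
move=> hQ; have := Cmod_triangle (1 - Q * Q ^ n) (Q * Q ^ n).
have -> : (1 - Q * Q ^ n + Q * Q ^ n = 1)%C by ring.
rewrite Cmod_1 Cmod_mult Cmod_pow.
have h0 := Cmod_ge_0 Q.
have := pow_unit (Cmod Q) n (conj h0 (Rlt_le _ _ hQ)); nra.
Qed.

(** A crude bound, factor by factor. Its exponential loss in [n] is later outweighed by the
    quadratic exponent of [q]. *)
Lemma qpoch_lower (Q : C) (n : nat) : Cmod Q < 1 ->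
  (1 - Cmod Q) ^ n <= Cmod (qpoch Q Q n).
Proof.
move=> hQ; elim: n => [|n IH] /=; first by rewrite Cmod_1; lra.
rewrite Cmod_mult Rmult_comm; apply: Rmult_le_compat => //.
- by apply: pow_le; lra.
- lra.
- exact: Cmod_1_sub_pow.
Qed.

Lemma qpoch_neq0 (Q : C) (n : nat) : Cmod Q < 1 -> qpoch Q Q n <> 0%C.
Proof.
move=> hQ e; have := qpoch_lower Q n hQ; rewrite e Cmod_0.
have : 0 < (1 - Cmod Q) ^ n by apply: pow_lt; lra.
lra.
Qed.

(** * The q-series *)

(** Here [M] is N_2 and [k] is N_1 - N_2; these coordinates keep truncated subtraction out of the
    identities below. *)
Definition summand (q : C) (a b c : nat) (x : C) (M k : nat) : C :=
  (q ^ (2 * ((M + k) * (M + k) + M * M) + a * k + b * M)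
   * qpoch_inf (- x * q ^ (1 + c + 2 * M)) (q * q) * x ^ (M + k + M)
   / (qpoch (q * q) (q * q) k * qpoch (q * q) (q * q) M))%C.

Definition layer (q : C) (a b c : nat) (x : C) (N : nat) : C :=
  sum_n (fun M => summand q a b c x M (N - M)) N.

Definition Ssum (q : C) (a b c : nat) (x : C) : C :=
  Cseq_lim (sum_n (layer q a b c x)).

Lemma Cmod_sq_lt1 (q : C) : Cmod q < 1 -> Cmod (q * q) < 1.
Proof. by move=> hq; rewrite Cmod_mult; have := Cmod_ge_0 q; nra. Qed.

Lemma qpoch_S (a Q : C) (n : nat) :
  qpoch a Q (S n) = (qpoch a Q n * (1 - a * Q ^ n))%C.
Proof. by []. Qed.

Lemma Csub_pow_neq0 (Q : C) (n : nat) : Cmod Q < 1 -> (1 - Q * Q ^ n)%C <> 0%C.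
Proof.
by move=> hQ e; have := Cmod_1_sub_pow Q n hQ; rewrite e Cmod_0; lra.
Qed.

Lemma summand_shift (q : C) (a b c : nat) (x : C) (M k : nat) :
  summand q a b c (x * (q * q)) M k =
  summand q (a + 2) (b + 4) (c + 2) x M k.
Proof.
rewrite /summand Cpow_mult_l.
have -> : (- (x * (q * q)) * q ^ (1 + c + 2 * M) =
           - x * q ^ (1 + (c + 2) + 2 * M))%C.
  have -> : (1 + (c + 2) + 2 * M = 2 + (1 + c + 2 * M))%nat by lia.
  rewrite (Cpow_add_r q 2) /=; ring.
have -> : (2 * ((M + k) * (M + k) + M * M) + (a + 2) * k + (b + 4) * M =
   2 * ((M + k) * (M + k) + M * M) + a * k + b * M + (M + k + M) + (M + k + M))%nat.
  by lia.
rewrite (Cpow_add_r q _ (M + k + M)) (Cpow_add_r q _ (M + k + M)) Cpow_mult_l.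
rewrite /Cdiv; ring.
Qed.

(** The first factor [1 + x q^(1+c+2M)] of the infinite product is expanded; its [q^(2M)] raises [b]
    by 2. *)
Lemma summand_c (q : C) (a b c : nat) (x : C) (M k : nat) : Cmod q < 1 ->
  summand q a b c x M k =
  (summand q a b (c + 2) x M k
   + x * q ^ (1 + c) * summand q a (b + 2) (c + 2) x M k)%C.
Proof.
move=> hq; rewrite /summand qpoch_inf_rec; last exact: Cmod_sq_lt1.
have -> : (- x * q ^ (1 + c + 2 * M) * (q * q) =
           - x * q ^ (1 + (c + 2) + 2 * M))%C.
  have -> : (1 + (c + 2) + 2 * M = 2 + (1 + c + 2 * M))%nat by lia.
  rewrite (Cpow_add_r q 2) /=; ring.
have -> : (2 * ((M + k) * (M + k) + M * M) + a * k + (b + 2) * M =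
   2 * ((M + k) * (M + k) + M * M) + a * k + b * M + 2 * M)%nat by lia.
rewrite (Cpow_add_r q (_ + b * M) (2 * M)) (Cpow_add_r q (1 + c) (2 * M)) /Cdiv.
ring.
Qed.

Lemma summand_a0 (q : C) (a b c : nat) (x : C) (M : nat) :
  summand q (a + 2) b c x M 0 = summand q a b c x M 0.
Proof. by rewrite /summand !Nat.mul_0_r. Qed.

(** The difference produces [1 - q^(2(k+1))], which cancels the last factor of the [q]-factorial in
    the denominator; expanding the square then re-indexes [k]. *)
Lemma summand_aS (q : C) (a b c : nat) (x : C) (M k : nat) : Cmod q < 1 ->
  (summand q a b c x M (S k) - summand q (a + 2) b c x M (S k) =
   x * q ^ (2 + a) * summand q (a + 4) (b + 4) c x M k)%C.
Proof.
move=> hq; have hQ := Cmod_sq_lt1 q hq; rewrite /summand qpoch_S.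
have -> : (2 * ((M + S k) * (M + S k) + M * M) + (a + 2) * S k + b * M =
  2 * ((M + S k) * (M + S k) + M * M) + a * S k + b * M + 2 * S k)%nat by lia.
have -> : (2 * ((M + S k) * (M + S k) + M * M) + a * S k + b * M =
  2 + a + (2 * ((M + k) * (M + k) + M * M) + (a + 4) * k + (b + 4) * M))%nat
  by lia.
have -> : (M + S k + M = S (M + k + M))%nat by lia.
rewrite (Cpow_S x) (Cpow_add_r q _ (2 * S k)) (Cpow_add_r q (2 + a) _).
rewrite (Cpow_mult_r q 2) Cpow_S.
have -> : (q ^ 2 = q * q)%C by rewrite /=; ring.
field; repeat split; try exact: qpoch_neq0; exact: Csub_pow_neq0.
Qed.

Lemma summand_b0 (q : C) (a b c : nat) (x : C) (k : nat) :
  summand q a (b + 2) c x 0 k = summand q a b c x 0 k.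
Proof. by rewrite /summand !Nat.mul_0_r. Qed.

(** The same cancellation in [M]. Both squares grow now, which explains the shift of [b] by 8, and
    the start of the infinite product moves, which raises [c]. *)
Lemma summand_bS (q : C) (a b c : nat) (x : C) (M k : nat) : Cmod q < 1 ->
  (summand q a b c x (S M) k - summand q a (b + 2) c x (S M) k =
   x * x * q ^ (4 + b) * summand q (a + 4) (b + 8) (c + 2) x M k)%C.
Proof.
move=> hq; have hQ := Cmod_sq_lt1 q hq; rewrite /summand qpoch_S.
have -> : (2 * ((S M + k) * (S M + k) + S M * S M) + a * k + (b + 2) * S M =
  2 * ((S M + k) * (S M + k) + S M * S M) + a * k + b * S M + 2 * S M)%nat by lia.
have -> : (2 * ((S M + k) * (S M + k) + S M * S M) + a * k + b * S M =
  4 + b + (2 * ((M + k) * (M + k) + M * M) + (a + 4) * k + (b + 8) * M))%nat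
  by lia.
have -> : (S M + k + S M = S (S (M + k + M)))%nat by lia.
have -> : (1 + c + 2 * S M = 1 + (c + 2) + 2 * M)%nat by lia.
rewrite !(Cpow_S x) (Cpow_add_r q _ (2 * S M)) (Cpow_add_r q (4 + b) _).
rewrite (Cpow_mult_r q 2) Cpow_S.
have -> : (q ^ 2 = q * q)%C by rewrite /=; ring.
field; repeat split; try exact: qpoch_neq0; exact: Csub_pow_neq0.
Qed.

Lemma Csum_scal (k : C) (u : nat -> C) (n : nat) :
  sum_n (fun i => k * u i)%C n = (k * sum_n u n)%C :> C.
Proof. exact: (sum_n_mult_l k u n). Qed.

Lemma Csum_S (u : nat -> C) (n : nat) :
  sum_n u (S n) = (sum_n u n + u (S n))%C :> C.
Proof. exact: sum_Sn. Qed.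

Lemma Csum_minus (u v : nat -> C) (n : nat) :
  sum_n (fun i => u i - v i)%C n = (sum_n u n - sum_n v n)%C :> C.
Proof.
elim: n => [|n IH]; first by rewrite !sum_O.
by rewrite !Csum_S IH; ring.
Qed.

Lemma Csum_split0 (u : nat -> C) (n : nat) :
  sum_n u (S n) = (u 0%nat + sum_n (fun i => u (S i)) n)%C :> C.
Proof.
elim: n => [|n IH]; first by rewrite Csum_S !sum_O.
by rewrite Csum_S IH Csum_S; ring.
Qed.

Lemma Csum_ext (u v : nat -> C) (n : nat) :
  (forall i, (i <= n)%nat -> u i = v i) -> sum_n u n = sum_n v n :> C.
Proof. exact: sum_n_ext_loc. Qed.

Lemma Cmod_sum_n_le (u : nat -> C) (B : R) (n : nat) :
  (forall i, (i <= n)%nat -> Cmod (u i) <= B) ->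
  Cmod (sum_n u n) <= INR (S n) * B.
Proof.
elim: n => [|n IH] H; first by rewrite sum_O /= Rmult_1_l; apply: H.
rewrite Csum_S S_INR Rmult_plus_distr_r Rmult_1_l.
apply: Rle_trans (Cmod_triangle _ _) _; apply: Rplus_le_compat; last exact: H.
by apply: IH => i hi; apply: H; lia.
Qed.

Lemma layer_shift (q : C) (a b c : nat) (x : C) (N : nat) :
  layer q a b c (x * (q * q)) N = layer q (a + 2) (b + 4) (c + 2) x N.
Proof. by apply: Csum_ext => M _; apply: summand_shift. Qed.

Lemma layer_c (q : C) (a b c : nat) (x : C) (N : nat) : Cmod q < 1 ->
  (layer q a b c x N - layer q a b (c + 2) x N =
   x * q ^ (1 + c) * layer q a (b + 2) (c + 2) x N)%C.
Proof.
move=> hq; rewrite /layer -Csum_minus -Csum_scal; apply: Csum_ext => M _.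
by rewrite (summand_c q a b c) //; ring.
Qed.

Lemma layer_a0 (q : C) (a b c : nat) (x : C) :
  layer q (a + 2) b c x 0 = layer q a b c x 0.
Proof. by rewrite /layer !sum_O summand_a0. Qed.

(** The last term of the layer has [k = 0] and cancels; the others keep [M] and lower [k], hence
    land in layer [N]. *)
Lemma layer_aS (q : C) (a b c : nat) (x : C) (N : nat) : Cmod q < 1 ->
  (layer q a b c x (S N) - layer q (a + 2) b c x (S N) =
   x * q ^ (2 + a) * layer q (a + 4) (b + 4) c x N)%C.
Proof.
move=> hq; rewrite /layer -Csum_minus -Csum_scal Csum_S Nat.sub_diag summand_a0.
rewrite /Cminus Cplus_opp_r Cplus_0_r; apply: Csum_ext => M hM.
by rewrite Nat.sub_succ_l // -summand_aS.
Qed.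

Lemma layer_b0 (q : C) (a b c : nat) (x : C) :
  layer q a (b + 2) c x 0 = layer q a b c x 0.
Proof. by rewrite /layer !sum_O summand_b0. Qed.

(** Here the first term, with [M = 0], cancels, and the others keep [k] and lower [M]. *)
Lemma layer_bS (q : C) (a b c : nat) (x : C) (N : nat) : Cmod q < 1 ->
  (layer q a b c x (S N) - layer q a (b + 2) c x (S N) =
   x * x * q ^ (4 + b) * layer q (a + 4) (b + 8) (c + 2) x N)%C.
Proof.
move=> hq; rewrite /layer -Csum_minus -Csum_scal Csum_split0 summand_b0.
rewrite /Cminus Cplus_opp_r Cplus_0_l; apply: Csum_ext => M _.
by rewrite -summand_bS.
Qed.

(** * Bounds and convergence *)

(** A majorant for [N + 1] terms, uniform in [a], [b], [c] and in [|x| <= X]; the power of [X]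
    reflects N_1 + N_2 <= 2 N_1. *)
Definition layer_bound (q : C) (X : R) (N : nat) : R :=
  INR (S N) * (exp (X / (1 - Cmod (q * q))) * (Cmod q ^ (2 * N * N) * X ^ (2 * N) *
   (/ (1 - Cmod (q * q))) ^ N)).

Lemma Rinv_pow_bound (d u : R) (n : nat) : 0 < d -> d ^ n <= u -> / u <= (/ d) ^ n.
Proof.
move=> hd h; rewrite -Rinv_pow_depr; last lra.
by apply: Rinv_le_contravar => //; apply: pow_lt.
Qed.

Lemma pow_le_anti (r : R) (n m : nat) : 0 <= r <= 1 -> (m <= n)%nat -> r ^ n <= r ^ m.
Proof.
move=> hr h; have -> : (n = m + (n - m))%nat by lia.
rewrite pow_add -[X in _ <= X]Rmult_1_r.
have h1 := pow_unit r m hr; have h2 := pow_unit r (n - m) hr; nra.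
Qed.

Lemma qpoch_inf_bound (q x : C) (X : R) (n : nat) : Cmod q < 1 -> Cmod x <= X ->
  Cmod (qpoch_inf (- x * q ^ n) (q * q)) <= exp (X / (1 - Cmod (q * q))).
Proof.
move=> hq hx; have hQ := Cmod_sq_lt1 q hq; apply: Cmod_le_dist1.
apply: Rle_trans (qpoch_inf_dist1 _ _ hQ) _.
apply: Rplus_le_compat_r; apply: exp_le_mono; apply: Rmult_le_compat_r.
  by left; apply: Rinv_0_lt_compat; lra.
rewrite Cmod_mult Cmod_opp Cmod_pow.
have h0 := Cmod_ge_0 x; have := pow_unit (Cmod q) n (conj (Cmod_ge_0 q) (Rlt_le _ _ hq)).
nra.
Qed.

(** From the exponent of [q] only [2(M+k)^2] is retained. The power of [|x|] stays exact, so that a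
    factor [|x|] can be extracted later. *)
Lemma summand_bound (q x : C) (X : R) (a b c M k : nat) :
  Cmod q < 1 -> 1 <= X -> Cmod x <= X ->
  Cmod (summand q a b c x M k) <=
  Cmod x ^ (M + k + M) *
  (exp (X / (1 - Cmod (q * q))) * (Cmod q ^ (2 * (M + k) * (M + k)) *
   (/ (1 - Cmod (q * q))) ^ (M + k))).
Proof.
move=> hq hX hx; have hQ := Cmod_sq_lt1 q hq.
have hd : 0 < 1 - Cmod (q * q) by lra.
have hq01 : 0 <= Cmod q <= 1 by split; [apply: Cmod_ge_0 | lra].
have n1 := qpoch_neq0 (q * q) k hQ; have n2 := qpoch_neq0 (q * q) M hQ.
rewrite /summand Cmod_div; last by apply: Cmult_neq_0.
rewrite !Cmod_mult !Cmod_pow /Rdiv Rinv_mult -!Cmod_mult.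
set A := Cmod q ^ _; set P := Cmod (qpoch_inf _ _); set Y := Cmod x ^ _.
set U := / Cmod (qpoch _ _ k); set V := / Cmod (qpoch _ _ M).
set E := exp _; set A' := Cmod q ^ _; set D := (/ _).
have hA : A <= A' by apply: pow_le_anti => //; lia.
have hA0 : 0 <= A by apply: pow_le; lra.
have hP : P <= E by apply: qpoch_inf_bound.
have hP0 : 0 <= P by apply: Cmod_ge_0.
have hY0 : 0 <= Y by apply: pow_le; apply: Cmod_ge_0.
have hU : U <= D ^ k by apply: Rinv_pow_bound => //; apply: qpoch_lower.
have hV : V <= D ^ M by apply: Rinv_pow_bound => //; apply: qpoch_lower.
have hU0 : 0 <= U by left; apply: Rinv_0_lt_compat; apply/Cmod_gt_0.
have hV0 : 0 <= V by left; apply: Rinv_0_lt_compat; apply/Cmod_gt_0.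
have -> : Y * (E * (A' * D ^ (M + k))) = (A' * E) * Y * (D ^ k * D ^ M).
  by rewrite pow_add; ring.
apply: Rmult_le_compat; try (by repeat apply: Rmult_le_pos).
- apply: Rmult_le_compat => //; first exact: Rmult_le_pos.
  - exact: Rmult_le_compat.
  - exact: Rle_refl.
- exact: Rmult_le_compat.
Qed.

Lemma layer_le (q x : C) (X : R) (a b c N : nat) :
  Cmod q < 1 -> 1 <= X -> Cmod x <= X ->
  Cmod (layer q a b c x N) <= layer_bound q X N.
Proof.
move=> hq hX hx; have hQ := Cmod_sq_lt1 q hq; apply: Cmod_sum_n_le => M hM.
have e : (M + (N - M) = N)%nat by lia.
apply: Rle_trans (summand_bound q x X _ _ _ _ _ hq hX hx) _; rewrite e.
have hY : Cmod x ^ (N + M) <= X ^ (2 * N).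
  apply: (Rle_trans _ (X ^ (N + M))); last by apply: Rle_pow => //; lia.
  by apply: pow_incr; split=> //; apply: Cmod_ge_0.
have h1 : 0 <= exp (X / (1 - Cmod (q * q))) by left; apply: exp_pos.
have h2 : 0 <= Cmod q ^ (2 * N * N) by apply: pow_le; apply: Cmod_ge_0.
have h3 : 0 <= (/ (1 - Cmod (q * q))) ^ N.
  by apply: pow_le; left; apply: Rinv_0_lt_compat; lra.
have h4 : 0 <= Cmod x ^ (N + M) by apply: pow_le; apply: Cmod_ge_0.
move: hY h1 h2 h3 h4; set y := Cmod x ^ _; set y' := X ^ _; set e1 := exp _.
set A := Cmod q ^ _; set D := (/ _) ^ _ => hY h1 h2 h3 h4.
have -> : e1 * (A * y' * D) = y' * (e1 * (A * D)) by ring.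
by apply: Rmult_le_compat_r => //; repeat apply: Rmult_le_pos.
Qed.

(** Every term outside layer 0 contains a positive power of [x]; this is the source of the estimate
    1 + O(x). *)
Lemma layer_le_x (q x : C) (X : R) (a b c N : nat) :
  Cmod q < 1 -> 1 <= X -> Cmod x <= X ->
  Cmod (layer q a b c x (S N)) <= Cmod x * layer_bound q X (S N).
Proof.
move=> hq hX hx; have hQ := Cmod_sq_lt1 q hq.
rewrite /layer_bound -Rmult_assoc (Rmult_comm (Cmod x)) Rmult_assoc.
apply: Cmod_sum_n_le => M hM.
have e : (M + (S N - M) = S N)%nat by lia.
apply: Rle_trans (summand_bound q x X _ _ _ _ _ hq hX hx) _; rewrite e.
have hY : Cmod x ^ (S N + M) <= Cmod x * X ^ (2 * S N).
  change (Cmod x * Cmod x ^ (N + M) <= Cmod x * X ^ (2 * S N)).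
  apply: Rmult_le_compat_l; first exact: Cmod_ge_0.
  apply: (Rle_trans _ (X ^ (N + M))); last by apply: Rle_pow => //; lia.
  by apply: pow_incr; split=> //; apply: Cmod_ge_0.
have h1 : 0 <= exp (X / (1 - Cmod (q * q))) by left; apply: exp_pos.
have h2 : 0 <= Cmod q ^ (2 * S N * S N) by apply: pow_le; apply: Cmod_ge_0.
have h3 : 0 <= (/ (1 - Cmod (q * q))) ^ S N.
  by apply: pow_le; left; apply: Rinv_0_lt_compat; lra.
move: hY h1 h2 h3; set y := Cmod x ^ _; set y' := X ^ (2 * S N); set e1 := exp _.
set A := Cmod q ^ _; set D := (/ _) ^ _ => hY h1 h2 h3.
have -> : Cmod x * (e1 * (A * y' * D)) = (Cmod x * y') * (e1 * (A * D)) by ring.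
by apply: Rmult_le_compat_r => //; do 2!(apply: Rmult_le_pos => //).
Qed.

Lemma INR_le_pow2 (n : nat) : INR (S n) <= 2 ^ n.
Proof.
elim: n => [|n IH]; first by rewrite /=; lra.
rewrite S_INR; have : 1 <= 2 ^ n by apply: pow_R1_Rle; lra.
by change (2 ^ S n) with (2 * 2 ^ n); lra.
Qed.

(** With [n + 1 <= 2^n] and one of the two factors [|q|^(n^2)] bounded by 1, the majorant is at most
    [E (Y |q|^n)^n]. Since [Y |q|^n] tends to 0, it is eventually dominated by powers of 1/2. *)
Lemma ex_series_layer_bound (q : C) (X : R) : Cmod q < 1 -> 1 <= X ->
  ex_series (layer_bound q X).
Proof.
move=> hq hX; have hQ := Cmod_sq_lt1 q hq.
set E := exp (X / (1 - Cmod (q * q))).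
set Y := 2 * (X * X * / (1 - Cmod (q * q))).
have hd : 0 < / (1 - Cmod (q * q)) by apply: Rinv_0_lt_compat; lra.
have hY : 0 < Y.
  by rewrite /Y; apply: Rmult_lt_0_compat; [lra|]; apply: Rmult_lt_0_compat => //; nra.
have hr : 0 <= Cmod q by apply: Cmod_ge_0.
have hbound n : layer_bound q X n <= E * (Y * Cmod q ^ n) ^ n.
  rewrite /layer_bound -/E.
  have -> : Cmod q ^ (2 * n * n) = (Cmod q ^ n) ^ n * (Cmod q ^ n) ^ n.
    rewrite -Rpow_mult_distr -pow_add -pow_mult; congr pow; lia.
  have -> : X ^ (2 * n) = (X * X) ^ n by rewrite pow_mult; congr pow; rewrite /=; ring.
  rewrite /Y !Rpow_mult_distr.
  have h1 := INR_le_pow2 n.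
  have hp : 0 <= (Cmod q ^ n) ^ n <= 1.
    by apply: pow_unit; apply: pow_unit; split=> //; lra.
  have h2 : 0 < X ^ n by apply: pow_lt; lra.
  have h3 : 0 < (/ (1 - Cmod (q * q))) ^ n by apply: pow_lt.
  have hE : 0 < E by apply: exp_pos.
  move: h1 hp h2 h3; set p := (_ ^ n) ^ n; set x := X ^ n; set d := (/ _) ^ n.
  set i := INR _ => h1 hp h2 h3.
  have h4 : 0 < x * x * d * E by repeat apply: Rmult_lt_0_compat.
  have -> : i * (E * (p * p * (x * x) * d)) = (i * (p * p)) * (x * x * d * E) by ring.
  have -> : E * (2 ^ n * (x * x * d) * p) = (2 ^ n * p) * (x * x * d * E) by ring.
  apply: Rmult_le_compat_r; first lra.
  have h5 : 0 <= i by apply: pos_INR.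
  apply: Rmult_le_compat => //; nra.
have [N0 HN0] : exists N0, forall n, (N0 <= n)%nat -> Y * Cmod q ^ n <= 1 / 2.
  have hl : is_lim_seq (fun n => Y * Cmod q ^ n) (Y * 0).
    have := is_lim_seq_scal_l (fun n => Cmod q ^ n) Y 0.
    apply; apply: is_lim_seq_geom; rewrite Rabs_pos_eq; lra.
  rewrite Rmult_0_r in hl; move/is_lim_seq_spec: hl => /(_ (mkposreal (1/2) ltac:(lra))).
  case=> N0 H; exists N0 => n hn; have := H n hn; rewrite /= Rminus_0_r.
  by move/Rlt_le => h; apply: Rle_trans (Rle_abs _) h.
apply/(ex_series_incr_n _ N0).
apply: (@ex_series_le _ R_CompleteNormedModule _ (fun k => E * (1 / 2) ^ k)).
- move=> n; rewrite /norm /= /abs /= Rabs_pos_eq; last first.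
    rewrite /layer_bound; repeat apply: Rmult_le_pos; try exact: pos_INR;
    try (apply: pow_le; lra); left; exact: exp_pos.
  apply: Rle_trans (hbound _) _; apply: Rmult_le_compat_l; first by left; apply: exp_pos.
  have h := HN0 (N0 + n)%nat ltac:(lia).
  have h0 : 0 <= Y * Cmod q ^ (N0 + n) by apply: Rmult_le_pos; [lra|apply: pow_le].
  apply: (Rle_trans _ ((1 / 2) ^ (N0 + n))); first by apply: pow_incr.
  by apply: pow_le_anti; [lra | lia].
- apply: ex_series_scal_l; exists (/ (1 - 1 / 2)); apply: is_series_geom.
  by rewrite Rabs_pos_eq; lra.
Qed.

Lemma SsumP (q : C) (a b c : nat) (x : C) : Cmod q < 1 ->
  Clim (sum_n (layer q a b c x)) (Ssum q a b c x).
Proof.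
move=> hq; set X := Rmax 1 (Cmod x).
have [l hl] : ex_series (layer q a b c x).
  apply: (@ex_series_le _ C_CompleteNormedModule _ (layer_bound q X)).
  - by move=> n; apply: layer_le => //; [apply: Rmax_l | apply: Rmax_r].
  - by apply: ex_series_layer_bound => //; apply: Rmax_l.
by apply: (Cseq_limP _ l); apply/is_series_Clim.
Qed.

Lemma Clim_minus (u v : nat -> C) (l m : C) :
  Clim u l -> Clim v m -> Clim (fun n => (u n - v n)%C) (l - m)%C.
Proof.
move=> H1 H2; apply: (Clim_le _ _ (fun n => Cmod (u n - l) + Cmod (v n - m))).
- move=> n; have -> : (u n - v n - (l - m) = (u n - l) - (v n - m))%C by ring.
  by apply: Rle_trans (Cmod_triangle _ _) _; rewrite Cmod_opp; right.
- by have := is_lim_seq_plus' _ _ _ _ H1 H2; rewrite Rplus_0_l.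
Qed.

(** * Relations between the double sums *)

Lemma series_sub_shift (A A' B : nat -> C) (s s' t k : C) :
  Clim (sum_n A) s -> Clim (sum_n A') s' -> Clim (sum_n B) t ->
  A' 0%nat = A 0%nat -> (forall N, (A (S N) - A' (S N) = k * B N)%C) ->
  s = (s' + k * t)%C.
Proof.
move=> hA hA' hB h0 hS.
have e : (s - s' = k * t)%C.
  (* The zeroth terms cancel, so partial sums up to [S n] on the left match those of [B] up to
     [n]. *)
  apply: (Clim_unique (fun n => (sum_n A (S n) - sum_n A' (S n))%C)).
    by apply: (proj2 (Clim_S (fun n => (sum_n A n - sum_n A' n)%C) _)); apply: Clim_minus.
  apply: (Clim_ext (fun n => (k * sum_n B n)%C)); last exact: Clim_scal.
  move=> n; rewrite -Csum_minus Csum_split0 h0 /Cminus Cplus_opp_r Cplus_0_l -Csum_scal.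
  by apply: Csum_ext => i _; rewrite -hS.
by rewrite -e; ring.
Qed.

Lemma Ssum_shift (q : C) (a b c : nat) (x : C) :
  Ssum q a b c (x * (q * q)) = Ssum q (a + 2) (b + 4) (c + 2) x.
Proof.
rewrite /Ssum; congr Cseq_lim; apply: functional_extensionality => n.
by apply: Csum_ext => N _; apply: layer_shift.
Qed.

Lemma Ssum_c (q : C) (a b c : nat) (x : C) : Cmod q < 1 ->
  (Ssum q a b c x = Ssum q a b (c + 2) x
   + x * q ^ (1 + c) * Ssum q a (b + 2) (c + 2) x)%C.
Proof.
move=> hq.
have e : (Ssum q a b c x - Ssum q a b (c + 2) x =
    x * q ^ (1 + c) * Ssum q a (b + 2) (c + 2) x)%C.
  apply: Clim_unique (Clim_minus _ _ _ _ (SsumP q a b c x hq)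
           (SsumP q a b (c + 2) x hq)) _.
  apply: (Clim_ext _ _ _ _ (Clim_scal _ _ _ (SsumP q a (b + 2) (c + 2) x hq))) => n.
  by rewrite -Csum_minus -Csum_scal; apply: Csum_ext => i _; rewrite layer_c.
by rewrite -e; ring.
Qed.

Lemma Ssum_a (q : C) (a b c : nat) (x : C) : Cmod q < 1 ->
  (Ssum q a b c x = Ssum q (a + 2) b c x
   + x * q ^ (2 + a) * Ssum q (a + 4) (b + 4) c x)%C.
Proof.
move=> hq; apply: series_sub_shift; try exact: SsumP.
- exact: layer_a0.
- by move=> N; apply: layer_aS.
Qed.

Lemma Ssum_b (q : C) (a b c : nat) (x : C) : Cmod q < 1 ->
  (Ssum q a b c x = Ssum q a (b + 2) c x
   + x * x * q ^ (4 + b) * Ssum q (a + 4) (b + 8) (c + 2) x)%C.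
Proof.
move=> hq; apply: series_sub_shift; try exact: SsumP.
- exact: layer_b0.
- by move=> N; apply: layer_bS.
Qed.

(** * The system of functional equations and its iteration *)

Definition step (q : C) (G : nat -> C -> C) (j : nat) (x : C) : C :=
  let y := (x * (q * q))%C in
  match j with
  | O => G 2%nat y
  | S O => ((1 + x * q) * G 2%nat y + y * G 1%nat y)%C
  | _ => ((1 + x * q) * G 2%nat y + y * (1 + x * q) * G 1%nat y
          + y * y * G 0%nat y)%C
  end.

(** As in [step], every index from 2 on stands for 2, so that the index can be a plain [nat]. *)
Definition Hgf (q : C) (j : nat) (x : C) : C :=
  match j with
  | O => Ssum q 2 4 2 x
  | S O => (Ssum q 2 2 0 x + x * (q * q) * Ssum q 4 6 2 x)%C
  | _ => Ssum q 0 0 0 x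
  end.

Lemma Hgf_step (q : C) (j : nat) (x : C) : Cmod q < 1 ->
  Hgf q j x = step q (Hgf q) j x.
Proof.
move=> hq; case: j => [|[|j]]; rewrite /step /Hgf !Ssum_shift //=.
(* Both sides become combinations of S(2,4,2), S(4,6,2) and S(6,10,4). *)
- have /= -> := Ssum_c q 2 2 0 x hq; have /= -> := Ssum_b q 2 2 2 x hq; ring.
(* Both sides are reduced to S(2,4,2), S(4,6,2), S(6,8,4), S(6,10,4) and S(8,12,4), after which the
   coefficients agree. *)
- have /= -> := Ssum_a q 0 0 0 x hq; have /= -> := Ssum_b q 2 0 0 x hq.
  have /= -> := Ssum_c q 2 2 0 x hq; have /= -> := Ssum_b q 2 2 2 x hq.
  have /= -> := Ssum_c q 4 4 0 x hq; have /= -> := Ssum_b q 4 4 2 x hq.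
  have /= -> := Ssum_a q 4 8 4 x hq; have /= -> := Ssum_c q 6 8 2 x hq; ring.
Qed.

Lemma sum_n_nonneg_le (u : nat -> R) (l : R) (n : nat) :
  (forall k, 0 <= u k) -> is_series u l -> sum_n u n <= l.
Proof.
move=> hu hl.
apply: (is_lim_seq_incr_compare (sum_n u) l) => // k.
by rewrite sum_Sn /plus /=; have := hu (S k); lra.
Qed.

Lemma layer_bound_ge0 (q : C) (X : R) (N : nat) : Cmod q < 1 -> 1 <= X ->
  0 <= layer_bound q X N.
Proof.
move=> hq hX; have hQ := Cmod_sq_lt1 q hq; have hr := Cmod_ge_0 q.
have hd : 0 < / (1 - Cmod (q * q)) by apply: Rinv_0_lt_compat; lra.
rewrite /layer_bound; apply: Rmult_le_pos; first exact: pos_INR.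
apply: Rmult_le_pos; first by left; apply: exp_pos.
by do 2!(try apply: Rmult_le_pos); apply: pow_le; lra.
Qed.

(** Layer 0 is a single infinite product, within a multiple of [|x|] of 1, and each later layer
    carries a factor [|x|]. *)
Lemma Ssum_dist1 (q : C) (X : R) : Cmod q < 1 -> 1 <= X ->
  exists K, 0 <= K /\ forall a b c x, Cmod x <= X ->
  Cmod (Ssum q a b c x - 1) <= K * Cmod x.
Proof.
move=> hq hX; have hQ := Cmod_sq_lt1 q hq.
have [B hB] := ex_series_layer_bound q X hq hX.
have hbn k := layer_bound_ge0 q X k hq hX.
have hB0 n : sum_n (layer_bound q X) n <= B by apply: sum_n_nonneg_le.
have hBpos : 0 <= B by have := hB0 0%nat; rewrite sum_O; have := hbn 0%nat; lra.
set d := / (1 - Cmod (q * q)).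
have hd : 0 < d by apply: Rinv_0_lt_compat; lra.
(* This comes from [exp u - 1 <= u * exp u] with [u <= |x| * d <= X * d]. *)
set K1 := d * exp (X * d).
have hK1 : 0 <= K1 by apply: Rmult_le_pos; left => //; apply: exp_pos.
exists (K1 + B); split; first lra.
move=> a b c x hx; have hx0 := Cmod_ge_0 x.
apply: (Clim_dist _ _ _ _ (SsumP q a b c x hq)) => n.
have h0 : Cmod (layer q a b c x 0 - 1) <= K1 * Cmod x.
  rewrite /layer sum_O /summand !Nat.mul_0_r /=.
  set P := qpoch_inf _ _.
  have -> : (1 * P * 1 / (1 * 1) - 1 = P - 1)%C.
    by field; exact: C1_nz.
  apply: Rle_trans (qpoch_inf_dist1 _ _ hQ) _.
  set u := Cmod _ / _.
  have hu0 : 0 <= u.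
    by apply: Rmult_le_pos; [apply: Cmod_ge_0 | left].
  have hux : u <= Cmod x * d.
    rewrite /u Cmod_mult Cmod_opp; apply: Rmult_le_compat_r; first by left.
    change (Cmod x * Cmod (q ^ (1 + c + 0)) <= Cmod x); rewrite Cmod_pow.
    have := pow_unit (Cmod q) (1 + c + 0) (conj (Cmod_ge_0 q) (Rlt_le _ _ hq)).
    by nra.
  apply: Rle_trans (exp_sub1_le _ hu0) _.
  have -> : K1 * Cmod x = (Cmod x * d) * exp (X * d) by rewrite /K1; ring.
  apply: Rmult_le_compat => //; first by left; apply: exp_pos.
  by apply: exp_le_mono; nra.
have hn : forall m, Cmod (sum_n (layer q a b c x) m - 1) <=
    K1 * Cmod x + Cmod x * sum_n (layer_bound q X) m.
  elim=> [|m IH].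
    by rewrite !sum_O; apply: Rle_trans h0 _; have := hbn 0%nat; nra.
  rewrite Csum_S sum_Sn.
  have -> : (sum_n (layer q a b c x) m + layer q a b c x (S m) - 1 =
    (sum_n (layer q a b c x) m - 1) + layer q a b c x (S m))%C by ring.
  apply: Rle_trans (Cmod_triangle _ _) _.
  have := layer_le_x q x X a b c m hq hX hx; rewrite /plus /=; lra.
by apply: Rle_trans (hn n) _; have := hB0 n; nra.
Qed.

Lemma Hgf_dist1 (q : C) (X : R) : Cmod q < 1 -> 1 <= X ->
  exists K, 0 <= K /\ forall j x, Cmod x <= X ->
  Cmod (1 - Hgf q j x) <= K * Cmod x.
Proof.
move=> hq hX; have [K [hK H]] := Ssum_dist1 q X hq hX.
(* The summand [1 + K * X] bounds S(4,6,2) in the extra term of [Hgf q 1]. *)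
exists (K + (1 + K * X)); split; first nra.
move=> j x hx; have hx0 := Cmod_ge_0 x.
have hKX : 0 <= K * X by apply: Rmult_le_pos; lra.
have hKx : 0 <= K * X * Cmod x by apply: Rmult_le_pos.
have -> : (1 - Hgf q j x = - (Hgf q j x - 1))%C by ring.
rewrite Cmod_opp; case: j => [|[|j]] /=.
- by have := H 2%nat 4%nat 2%nat x hx; nra.
- set s := Ssum q 4 6 2 x.
  have hs : Cmod s <= 1 + K * X.
    by apply: Cmod_le_dist1; have := H 4%nat 6%nat 2%nat x hx; rewrite -/s; nra.
  have -> : (Ssum q 2 2 0 x + x * (q * q) * s - 1 =
     (Ssum q 2 2 0 x - 1) + x * (q * q) * s)%C by ring.
  apply: Rle_trans (Cmod_triangle _ _) _.
  rewrite Cmod_mult (Cmod_mult x) Rmult_plus_distr_r.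
  apply: Rplus_le_compat; first exact: H.
  have h1 := Cmod_sq_lt1 q hq; have h2 := Cmod_ge_0 (q * q); have h3 := Cmod_ge_0 s.
  rewrite (Rmult_comm (Cmod x)) Rmult_assoc.
  rewrite -[X in _ <= X]Rmult_1_l (Rmult_comm (1 + _)).
  apply: Rmult_le_compat => //; [nra | lra | nra].
- by have := H 0%nat 0%nat 0%nat x hx; nra.
Qed.

(** The polynomial is [(1 + u) + u (1 + u) + u^2], the sum of the coefficient bounds in the last
    case of [step]. It lies below the square of [1 + 2 u]. *)
Lemma exp_ge_quad (u : R) : 0 <= u -> 1 + 2 * u + 2 * (u * u) <= exp (4 * u).
Proof.
move=> hu; have h := exp_ineq1_le (2 * u).
have -> : 4 * u = 2 * u + 2 * u by ring.
rewrite exp_plus; nra.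
Qed.

(** The Lipschitz constant is put in exponential form because the constants of successive iterations
    are multiplied. *)
Lemma step_dist (q : C) (G H : nat -> C -> C) (j : nat) (x : C) (e : R) :
  Cmod q < 1 -> (forall i, Cmod (G i (x * (q * q))%C - H i (x * (q * q))%C) <= e) ->
  Cmod (step q G j x - step q H j x) <= exp (4 * Cmod x) * e.
Proof.
move=> hq hGH; have he : 0 <= e by apply: Rle_trans (Cmod_ge_0 _) (hGH 0%nat).
have hx := Cmod_ge_0 x; have hq0 := Cmod_ge_0 q.
set u := Cmod x in hx *.
have hE := exp_ge_quad u hx.
have h1 : Cmod (1 + x * q) <= 1 + u.
  apply: Rle_trans (Cmod_triangle _ _) _; rewrite Cmod_1 Cmod_mult -/u; nra.
have h2 : Cmod (x * (q * q)) <= u.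
  rewrite Cmod_mult -/u; have := Cmod_sq_lt1 q hq; have := Cmod_ge_0 (q * q); nra.
have p1 := Cmod_ge_0 (1 + x * q); have p2 := Cmod_ge_0 (x * (q * q)).
apply: (Rle_trans _ ((1 + 2 * u + 2 * (u * u)) * e)); last first.
  by apply: Rmult_le_compat_r.
rewrite /step; cbv zeta; move: hGH p2 h2; move: (x * (q * q))%C => y hGH p2 h2.
have d0 := hGH 0%nat; have d1 := hGH 1%nat; have d2 := hGH 2%nat.
have g0 := Cmod_ge_0 (G 0%nat y - H 0%nat y).
have g1 := Cmod_ge_0 (G 1%nat y - H 1%nat y).
have g2 := Cmod_ge_0 (G 2%nat y - H 2%nat y).
have k2 : Cmod (1 + x * q) * Cmod (G 2%nat y - H 2%nat y) <= (1 + u) * e.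
  exact: Rmult_le_compat.
have k1 : Cmod y * Cmod (G 1%nat y - H 1%nat y) <= u * e.
  exact: Rmult_le_compat.
have hue : 0 <= u * e by apply: Rmult_le_pos.
have huue : 0 <= u * (u * e) by apply: Rmult_le_pos.
case: j => [|[|j]].
- lra.
- have -> : ((1 + x * q) * G 2%nat y + y * G 1%nat y
    - ((1 + x * q) * H 2%nat y + y * H 1%nat y) =
    (1 + x * q) * (G 2%nat y - H 2%nat y) + y * (G 1%nat y - H 1%nat y))%C by ring.
  apply: Rle_trans (Cmod_triangle _ _) _; rewrite !Cmod_mult.
  lra.
- have -> : ((1 + x * q) * G 2%nat y + y * (1 + x * q) * G 1%nat y + y * y * G 0%nat y
    - ((1 + x * q) * H 2%nat y + y * (1 + x * q) * H 1%nat y + y * y * H 0%nat y) =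
    (1 + x * q) * (G 2%nat y - H 2%nat y)
    + ((1 + x * q) * (y * (G 1%nat y - H 1%nat y)))
    + y * (y * (G 0%nat y - H 0%nat y)))%C by ring.
  apply: Rle_trans (Cmod_triangle _ _) _.
  apply: Rle_trans (Rplus_le_compat_r _ _ _ (Cmod_triangle _ _)) _.
  rewrite !Cmod_mult.
  have k3 : Cmod (1 + x * q) * (Cmod y * Cmod (G 1%nat y - H 1%nat y)) <= (1 + u) * (u * e).
    by apply: Rmult_le_compat => //; apply: Rmult_le_pos.
  have k0 : Cmod y * (Cmod y * Cmod (G 0%nat y - H 0%nat y)) <= u * (u * e).
    apply: Rmult_le_compat => //; first exact: Rmult_le_pos.
    exact: Rmult_le_compat.
  lra.
Qed.

(** After [N] iterations the initial error is evaluated at [x q^(2N)], where it is at most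
    [K |x| |q^2|^N]. The accumulated Lipschitz constants stay bounded, their exponents forming a
    geometric sum. *)
Lemma iterate_step_dist (q : C) (X K : R) (H : nat -> C -> C) (P : nat -> nat -> C -> C) :
  Cmod q < 1 -> 0 <= K ->
  (forall j x, H j x = step q H j x) ->
  (forall j x, Cmod x <= X -> Cmod (1 - H j x) <= K * Cmod x) ->
  (forall j x, P 0%nat j x = 1%C) ->
  (forall N j x, P (S N) j x = step q (P N) j x) ->
  forall N j x, Cmod x <= X ->
  Cmod (P N j x - H j x) <=
    exp (4 * Cmod x / (1 - Cmod (q * q))) * (K * Cmod x) * Cmod (q * q) ^ N.
Proof.
move=> hq hK hH h1 hP0 hPS; have hQ := Cmod_sq_lt1 q hq.
set d := 1 - Cmod (q * q) in hQ *; have hd : 0 < d by rewrite /d; lra.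
have hQ0 := Cmod_ge_0 (q * q).
elim=> [|N IH] j x hx; have hx0 := Cmod_ge_0 x.
  rewrite hP0 Rmult_1_r; apply: Rle_trans (h1 _ _ hx) _.
  have : 1 <= exp (4 * Cmod x / d).
    by apply: exp_ge1; apply: Rmult_le_pos; [lra | left; apply: Rinv_0_lt_compat].
  have : 0 <= K * Cmod x by apply: Rmult_le_pos.
  move: (exp _) (_ * _) => A B; nra.
rewrite hPS hH.
have e : Cmod (x * (q * q)) = Cmod x * Cmod (q * q) by rewrite Cmod_mult.
have hx' : Cmod (x * (q * q)) <= X by rewrite e; nra.
apply: Rle_trans (step_dist q _ _ j x _ hq (fun i => IH i _ hx')) _.
right; rewrite e.
(* The first term of the geometric sum is split off; the remainder is the same sum at [x q^2]. *)
have -> : 4 * Cmod x / d = 4 * Cmod x + 4 * (Cmod x * Cmod (q * q)) / d.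
  by rewrite /d; field; rewrite -/d; lra.
by rewrite exp_plus /=; ring.
Qed.

(** This will be applied twice: at [q] and [x], and at their moduli to obtain absolute
    convergence. *)
Lemma iterate_step_lim (q : C) (P : nat -> nat -> C -> C) (j : nat) (x : C) :
  Cmod q < 1 ->
  (forall j x, P 0%nat j x = 1%C) ->
  (forall N j x, P (S N) j x = step q (P N) j x) ->
  Clim (fun N => P N j x) (Hgf q j x).
Proof.
move=> hq hP0 hPS; set X := Rmax 1 (Cmod x).
have [K [hK hH]] := Hgf_dist1 q X hq (Rmax_l _ _).
have hb := iterate_step_dist q X K (Hgf q) P hq hK
  (fun j x => Hgf_step q j x hq) hH hP0 hPS.
apply: Clim_le (fun N => hb N j x (Rmax_r _ _)) _.
have hQ := Cmod_sq_lt1 q hq.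
have := is_lim_seq_scal_l (fun N => Cmod (q * q) ^ N)
  (exp (4 * Cmod x / (1 - Cmod (q * q))) * (K * Cmod x)) 0.
rewrite /= Rmult_0_r; apply; apply: is_lim_seq_geom.
by rewrite Rabs_pos_eq //; apply: Cmod_ge_0.
Qed.

(** * Partitions with parts at most 2N *)

(* The [nat] notations are Stdlib's above this line and ssrnat's below. *)
From mathcomp Require Import all_boot zify.
Local Open Scope nat_scope.

(** Inverse of removing the small parts and lowering the rest by 2; [f] records the multiplicities
    of 1 and 2. *)
Definition lift2 (f : nat * nat) (t : seq nat) : seq nat :=
  map (addn 2) t ++ nseq f.2 2 ++ nseq f.1 1.

Definition small_parts : seq (nat * nat) :=
  [:: (0, 0); (1, 0); (0, 1); (1, 1); (0, 2)].

(** The allowance for [t] is [2 - f.2] because its parts 1 and 2 become 3 and 4, which share the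
    window [[2, 4]] with the twos. *)
Fixpoint parts (N j : nat) : seq (seq nat) :=
  if N is N'.+1 then
    [seq lift2 f t | f <- [seq f <- small_parts | f.1 + f.2 <= j],
                     t <- parts N' (2 - f.2)]
  else [:: [::]].

Definition admissible (j : nat) (s : seq nat) : Prop :=
  [/\ all (fun p => 0 < p) s, sorted geq s,
      forall k, odd k -> count_mem k s <= 1,
      forall m, count (fun p => m.*2 <= p <= m.*2.+2) s <= 2 &
      count (fun p => p <= 2) s <= j].

Lemma geq_trans : transitive geq.
Proof. by move=> y x z /= hxy hyz; apply: leq_trans hyz hxy. Qed.

Lemma cond_iE (s : seq nat) :
  cond_i s <-> forall k, odd k -> count_mem k s <= 1.
Proof.
split=> [/allP h k ok|h]; last by apply/allP => k _; apply/implyP; apply: h.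
case ks: (k \in s); first by have := h k ks; rewrite ok.
by rewrite (count_memPn _) ?ks.
Qed.

Lemma cond_iiE (s : seq nat) :
  cond_ii s <-> forall i, i + 2 < size s ->
    (nth 0 s (i + 2) + 2 <= nth 0 s i) /\
    (~~ odd (nth 0 s i) -> nth 0 s (i + 2) + 2 < nth 0 s i).
Proof.
split=> [/allP h i hi|h].
  have /h /andP[h1 /implyP h2] : i \in iota 0 (size s - 2).
    by rewrite mem_iota; lia.
  by [].
apply/allP => i; rewrite mem_iota => hi.
have [|-> /implyP ->] // := h i; lia.
Qed.

(** Three parts in one window include three consecutive ones, which violate the gap condition;
    conversely, a violation at [i] puts the parts [i], [i + 1], [i + 2] in a common window. *)
Lemma cond_ii_window (s : seq nat) : sorted geq s ->
  cond_ii s <-> forall m, count (fun p => m.*2 <= p <= m.*2.+2) s <= 2.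
Proof.
move=> ss; rewrite cond_iiE; split=> [h m|h i hi].
  elim: s ss h => [//|a s IH] ss h.
  have {IH} IH : count (fun p => m.*2 <= p <= m.*2.+2) s <= 2.
    by apply: IH => [|i hi]; [apply: path_sorted ss | apply: (h i.+1)].
  rewrite [count _ _]/=; case ha: (_ <= a <= _); last by [].
  case: s ss h IH => [|b [|c r]] // ss h _; first by rewrite /=; lia.
  have [//|h1 h2] := h 0; rewrite /= in h1 h2.
  (* An odd [a] in the window is at most [2m + 1], so [c <= a - 2] suffices; an even [a] may equal
     [2m + 2], and the strict inequality is used. *)
  have hc : c < m.*2 by case oa: (odd a) h2 => h2; lia.
  rewrite add1n ltnS.
  have -> : count (fun p => m.*2 <= p <= m.*2.+2) (b :: c :: r) =
     (m.*2 <= b <= m.*2.+2) + count (fun p => m.*2 <= p <= m.*2.+2) (c :: r) by [].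
  rewrite (_ : count _ (c :: r) = 0); first by case: (_ <= b <= _).
  apply/eqP; rewrite -leqn0 leqNgt -has_count; apply/hasPn => p pr.
  have : p <= c.
    have cr : path geq c r by case/and3P: ss.
    move: pr; rewrite inE => /orP[/eqP -> //|].
    by move: p; apply/allP; apply: order_path_min cr; apply: geq_trans.
  lia.
set a := nth 0 s i; set c := nth 0 s (i + 2).
have hd : drop i s = [:: a, nth 0 s i.+1, c & drop i.+3 s].
  by rewrite /c addn2 (drop_nth 0) ?(drop_nth 0 (n := i.+1)) ?(drop_nth 0 (n := i.+2)) //; lia.
have sd : sorted geq (drop i s) by apply: drop_sorted.
rewrite hd /= in sd; case/and3P: sd => hab hbc _.
have hm m : m.*2 <= c -> a <= m.*2.+2 -> False.
  move=> h1 h2; have := h m; rewrite -(cat_take_drop i s) count_cat hd /=.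
  have -> : m.*2 <= a <= m.*2.+2 by lia.
  have -> : m.*2 <= c <= m.*2.+2 by lia.
  have -> : m.*2 <= nth 0 s i.+1 <= m.*2.+2 by lia.
  lia.
(* The relevant window is [[a - 1, a + 1]] for odd [a] and [[a - 2, a]] for positive even [a]. *)
have := hm a./2; have := hm a./2.-1; have := odd_double_half a.
case: (odd a) => e H1 H2; split; lia.
Qed.

Lemma admissibleE (s : seq nat) :
  [/\ all (fun p => 0 < p) s, sorted geq s, cond_i s, cond_ii s & cond_iii s]
  <-> admissible 2 s.
Proof.
split=> [[h1 h2 h3 h4 h5]|[h1 h2 h3 h4 h5]]; split=> //.
- exact/cond_iE.
- exact/cond_ii_window.
- exact/cond_iE.
- exact/cond_ii_window.
Qed.

Lemma lift2_decomp (s : seq nat) : all (fun p => 0 < p) s -> sorted geq s ->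
  s = lift2 (count_mem 1 s, count_mem 2 s)
            [seq p - 2 | p <- [seq p <- s | 2 < p]].
Proof.
rewrite /lift2; elim: s => [//|a s IH] /= /andP[a0 ps] pa.
have hs := IH ps (path_sorted pa).
have /allP hle : all (geq a) s by apply: order_path_min pa; apply: geq_trans.
case: (ltnP 2 a) => [a2|a2].
  have -> : (a == 1) = false by apply/eqP; lia.
  have -> : (a == 2) = false by apply/eqP; lia.
  rewrite [X in _ :: X = _]hs /= !add0n; congr (_ :: _); lia.
have e0 : [seq p <- s | 2 < p] = [::].
  by apply/eqP; rewrite -size_eq0 size_filter -leqn0 leqNgt -has_count;
     apply/hasPn => p /hle /=; lia.
rewrite e0 /= in hs *.
have [ea|ea] : a = 2 \/ a = 1 by lia.
  by rewrite ea /= [X in _ :: X]hs.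
have c2 : count_mem 2 s = 0 by apply/count_memPn; apply/negP => /hle /=; rewrite ea.
by rewrite ea /= [X in _ :: X]hs c2.
Qed.

Lemma admissible_lift2 (j : nat) (f : nat * nat) (t : seq nat) :
  f \in small_parts -> f.1 + f.2 <= j -> admissible (2 - f.2) t ->
  admissible j (lift2 f t).
Proof.
move=> fs fj [t0 st todd twin tsmall]; split.
- by rewrite !all_cat all_map !all_nseq !orbT !andbT; apply/allP => p _ /=; lia.
- rewrite sorted_pairwise ?pairwise_cat -?sorted_pairwise; try exact: geq_trans.
  apply/and3P; split.
  - apply/allrelP => x y /mapP[p pt ->]; rewrite mem_cat !mem_nseq => h.
    by move/allP: t0 => /(_ p pt) /=; move: h; lia.
  - rewrite sorted_map; move: st; apply: sub_sorted => x y /=; lia.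
  - by move: fs; rewrite !inE => /or4P[||| /orP[]] /eqP ->.
- move=> k ok; rewrite !count_cat count_map !count_nseq /=.
  have f1 : f.1 <= 1 by move: fs; rewrite !inE => /or4P[||| /orP[]] /eqP ->.
  have -> : (2 == k) = false by apply/eqP => e; rewrite -e in ok.
  rewrite mul0n add0n; have [k1|k1] := eqVneq 1 k.
    rewrite -k1 mul1n (_ : count _ t = 0) //.
    by apply/eqP; rewrite -leqn0 leqNgt -has_count; apply/hasPn => p _ /=; lia.
  rewrite mul0n addn0; apply: leq_trans (todd (k - 2) _); last by lia.
  by apply: sub_count => p /=; lia.
- move=> m; rewrite !count_cat count_map !count_nseq /=.
  have f2 : f.1 + f.2 <= 2 by move: fs; rewrite !inE => /or4P[||| /orP[]] /eqP ->.
  (* The window [[0, 2]] sees only the new parts; [[2, 4]] sees the new twos and the lifted parts of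
     [t] at most 2; any later window is a window of [t] raised by 2. *)
  case: m => [|[|m]].
  - rewrite !mul1n (_ : count _ t = 0); first by rewrite add0n addnC.
    apply/eqP; rewrite -leqn0 leqNgt -has_count; apply/hasPn => p pt /=.
    by move/allP: t0 => /(_ p pt); lia.
  - have : count (preim (addn 2) (fun p => 1.*2 <= p <= 1.*2.+2)) t <= 2 - f.2.
      by apply: leq_trans tsmall; apply: sub_count => p /=; lia.
    have -> : (1.*2 <= 1 <= 1.*2.+2) = false by [].
    have -> : (1.*2 <= 2 <= 1.*2.+2) = true by [].
    lia.
  - have : count (preim (addn 2) (fun p => m.+2.*2 <= p <= m.+2.*2.+2)) t <= 2.
      by apply: leq_trans (twin m.+1); apply: sub_count => p /=; lia.
    have -> : (m.+2.*2 <= 1 <= m.+2.*2.+2) = false by lia.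
    lia.
- rewrite !count_cat count_map !count_nseq /= (_ : count _ t = 0); first by lia.
  apply/eqP; rewrite -leqn0 leqNgt -has_count; apply/hasPn => p pt /=.
  by move/allP: t0 => /(_ p pt); lia.
Qed.

Lemma count_small (s : seq nat) : all (fun p => 0 < p) s ->
  count (fun p => p <= 2) s = count_mem 1 s + count_mem 2 s.
Proof.
elim: s => [//|a s IH] /= /andP[a0 /IH ->].
by case: a a0 => [|[|[|a]]] //= _; lia.
Qed.

Lemma admissible_unlift (j : nat) (s : seq nat) : admissible j s ->
  let f := (count_mem 1 s, count_mem 2 s) in
  [/\ f \in small_parts, f.1 + f.2 <= j &
      admissible (2 - f.2) [seq p - 2 | p <- [seq p <- s | 2 < p]]].
Proof.
move=> [s0 ss sodd swin ssmall] /=.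
have c2 := swin 0.
have e2 : count (fun p => 0.*2 <= p <= 0.*2.+2) s = count_mem 1 s + count_mem 2 s.
  by rewrite -count_small //; apply: eq_count => p /=; lia.
rewrite e2 in c2; rewrite count_small // in ssmall.
split=> //.
  have := sodd 1 isT; rewrite /small_parts !inE /eq_op /=.
  by case: (count_mem 1 s) c2 => [|[|?]]; case: (count_mem 2 s) => [|[|[|?]]].
split.
- by rewrite all_map; apply/allP => p; rewrite mem_filter /= => /andP[]; lia.
- rewrite sorted_map; have := sorted_filter geq_trans (fun p => 2 < p) ss.
  by apply: sub_sorted => x y /=; lia.
- move=> k ok; rewrite count_map count_filter.
  apply: leq_trans (sodd k.+2 _); last by rewrite /= negbK.
  by apply: sub_count => p /=; lia.
- move=> m; rewrite count_map count_filter; apply: leq_trans (swin m.+1).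
  by apply: sub_count => p /=; lia.
- rewrite count_map count_filter.
  rewrite leq_subRL; last exact: leq_trans (leq_addl _ _) c2.
  (* The twos and the parts 3 and 4 are disjoint families inside the window [[2, 4]], so the
     intersection term is 0. *)
  apply: leq_trans (swin 1); rewrite -count_predUI -[X in _ <= X]addn0.
  apply: leq_add; first by apply: sub_count => p /=; lia.
  by rewrite leqNgt -has_count; apply/hasPn => p _ /=; lia.
Qed.

Lemma mem_parts (N j : nat) (s : seq nat) :
  s \in parts N j <-> admissible j s /\ all (fun p => p <= N.*2) s.
Proof.
elim: N j s => [|N IH] j s.
  rewrite /= inE; split=> [/eqP -> //|[[s0 _ _ _ _] s1]].
  by case: s s0 s1 => [//|a s] /= /andP[a0 _] /andP[a1 _]; lia.
split.
  case/allpairsPdep => f [t [+ /IH [tad tle] ->]]; rewrite mem_filter => /andP[fj fs].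
  split; first exact: admissible_lift2.
  rewrite !all_cat all_map !all_nseq; apply/and3P; split.
  - by move: tle; apply: sub_all => p /=; lia.
  - by apply/orP; right; lia.
  - by apply/orP; right; lia.
case=> sad sle; have [fs fj tad] := admissible_unlift _ _ sad.
have [s0 ss _ _ _] := sad.
apply/allpairsPdep; exists (count_mem 1 s, count_mem 2 s).
exists [seq p - 2 | p <- [seq p <- s | 2 < p]]; split.
- by rewrite mem_filter fj.
- apply/IH; split=> //; rewrite all_map; apply/allP => p; rewrite mem_filter.
  by case/andP => _ /(allP sle) /=; lia.
- exact: lift2_decomp.
Qed.

(** The pair [(f, t)] is recovered from [lift2 f t]: the parts of [t] are positive, so the lifted
    ones exceed 2 and cannot be confused with the new ones. *)
Lemma uniq_parts (N j : nat) : uniq (parts N j).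
Proof.
elim: N j => [//|N IH] j; apply: allpairs_uniq_dep.
- by apply: filter_uniq.
- by move=> f _; apply: IH.
pose g s := Tagged (fun _ : nat * nat => seq nat)
  [seq p - 2 | p <- [seq p <- s | 2 < p]] : {x : nat * nat & seq nat}.
pose unlift s := existT (fun _ : nat * nat => seq nat) (count_mem 1 s, count_mem 2 s)
  [seq p - 2 | p <- [seq p <- s | 2 < p]].
apply: (can_in_inj (g := unlift)) => _ /allpairsPdep[f [t [_ /mem_parts[[t0 _ _ _ _] _] ->]]].
have c0 k : k <= 2 -> count (preim (addn 2) (pred1 k)) t = 0.
  move=> hk; apply/eqP; rewrite -leqn0 leqNgt -has_count; apply/hasPn => p pt /=.
  by move/allP: t0 => /(_ p pt); lia.
rewrite /unlift /lift2 /= !count_cat !count_map !count_nseq !c0 //=.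
rewrite mul0n mul1n !add0n mul0n addn0 mul1n !filter_cat.
rewrite [X in _ ++ X](_ : _ = [::]); last first.
  by apply/eqP; rewrite -size_eq0 size_cat !size_filter !count_nseq.
rewrite cats0 (_ : map _ _ = t); first by case: f.
rewrite (@eq_in_filter _ _ predT) ?filter_predT; last first.
  by move=> _ /mapP[p /(allP t0) /= hp ->]; lia.
by rewrite -map_comp -[RHS]map_id; apply: eq_map => p /=; lia.
Qed.

Lemma leq_sumn (s : seq nat) (p : nat) : p \in s -> p <= sumn s.
Proof.
elim: s => [//|a s IH]; rewrite inE => /orP[/eqP ->|/IH h] /=; lia.
Qed.

Lemma size_le_sumn (s : seq nat) : all (fun p => 0 < p) s -> size s <= sumn s.
Proof. by elim: s => [//|a s IH] /= /andP[a0 /IH]; lia. Qed.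

(** A single list serves all [n <= 2K], since the parts of a partition of [n] are at most [n]. The
    same bound makes the passage to ['I_n.+1] lossless. *)
Lemma B_count (K l n : nat) : n <= K.*2 ->
  B l n = count (fun s => (size s == l) && (sumn s == n)) (parts K 2).
Proof.
move=> nK; rewrite /B cardE -size_filter.
set A := [set t | _]; set v := fun t : l.-tuple 'I_n.+1 => map val t.
rewrite -(size_map v); apply: perm_size; apply: uniq_perm.
- rewrite map_inj_uniq ?enum_uniq // => t u; rewrite /v => /(inj_map val_inj) e.
  exact: val_inj.
- by apply: filter_uniq; apply: uniq_parts.
move=> s; rewrite mem_filter; apply/mapP/andP.
- case=> t; rewrite mem_enum inE => /and4P[/and4P[sl sn s0 ss] h1 h2 h3] ->.
  rewrite sl sn; split=> //; apply/mem_parts; split; first exact/admissibleE.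
  by apply/allP => p /leq_sumn; move/eqP: sn => ->; lia.
- case=> /andP[/eqP sl /eqP sn] /mem_parts[/admissibleE[s0 ss h1 h2 h3] _].
  have hs : all (fun p => p < n.+1) s by apply/allP => p /leq_sumn; lia.
  have sz : size [seq inord p : 'I_n.+1 | p <- s] == l by rewrite size_map sl.
  have e : s = v (Tuple sz).
    rewrite /v /= -map_comp -[LHS]map_id; apply/eq_in_map => p /(allP hs) hp /=.
    by rewrite inordK.
  exists (Tuple sz) => //; rewrite mem_enum inE.
  by rewrite /v /= in e; rewrite /= -e /is_partition sl sn !eqxx s0 ss h1 h2 h3.
Qed.

(** * Generating functions *)

Local Open Scope R_scope.

(** These laws give [\big] sums over complex and real numbers access to reindexing and splitting. *)
Lemma Cplus_associative : associative Cplus. Proof. exact: Cplus_assoc. Qed.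
Lemma Cplus_commutative : commutative Cplus. Proof. exact: Cplus_comm. Qed.
Lemma Cplus_left_id : left_id (RtoC 0) Cplus. Proof. exact: Cplus_0_l. Qed.
HB.instance Definition _ := Monoid.isComLaw.Build C (RtoC 0) Cplus
  Cplus_associative Cplus_commutative Cplus_left_id.

Lemma Rplus_associative : associative Rplus.
Proof. by move=> x y z; rewrite Rplus_assoc. Qed.
Lemma Rplus_commutative : commutative Rplus. Proof. exact: Rplus_comm. Qed.
Lemma Rplus_left_id : left_id 0 Rplus. Proof. exact: Rplus_0_l. Qed.
HB.instance Definition _ := Monoid.isComLaw.Build R 0 Rplus
  Rplus_associative Rplus_commutative Rplus_left_id.

Definition weight (q x : C) (s : seq nat) : C := (x ^ size s * q ^ sumn s)%C.

Definition rweight (q x : C) (s : seq nat) : R :=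
  (Cmod x ^ size s * Cmod q ^ sumn s)%R.

Lemma Cmod_weight (q x : C) (s : seq nat) : Cmod (weight q x s) = rweight q x s.
Proof. by rewrite Cmod_mult !Cmod_pow. Qed.

Lemma rweight_ge0 (q x : C) (s : seq nat) : 0 <= rweight q x s.
Proof. by rewrite -Cmod_weight; apply: Cmod_ge_0. Qed.

Definition parts_gf (q : C) (N j : nat) (x : C) : C :=
  \big[Cplus/RtoC 0]_(s <- parts N j) weight q x s.

Lemma Cbig_scal (T : Type) (r : seq T) (k : C) (F : T -> C) :
  \big[Cplus/RtoC 0]_(i <- r) (k * F i)%C = (k * \big[Cplus/RtoC 0]_(i <- r) F i)%C.
Proof.
elim: r => [|i r IH]; first by rewrite !big_nil; ring.
by rewrite !big_cons IH; ring.
Qed.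

(** Raising every part of [t] by 2 contributes [q^2] per part, which is absorbed by replacing [x]
    with [x q^2]. *)
Lemma weight_lift2 (q x : C) (f : nat * nat) (t : seq nat) :
  weight q x (lift2 f t) =
  (x ^ (f.1 + f.2) * q ^ (f.1 + 2 * f.2) * weight q (x * (q * q)) t)%C.
Proof.
rewrite /weight /lift2 !size_cat size_map !size_nseq !sumn_cat !sumn_nseq.
have -> : sumn (map (addn 2) t) = (size t + size t + sumn t)%N.
  by elim: t => [//|a t IH] /=; lia.
rewrite (_ : size t + _ = f.1 + f.2 + size t)%N; last lia.
rewrite (_ : size t + size t + _ + _ = f.1 + 2 * f.2 + (size t + size t + sumn t))%N; last lia.
rewrite !Cpow_add_r !Cpow_mult_l; ring.
Qed.

Lemma parts_gf0 (q : C) (j : nat) (x : C) : parts_gf q 0 j x = 1%C.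
Proof. by rewrite /parts_gf big_seq1 /weight /=; ring. Qed.

Lemma parts_gfS (q : C) (N j : nat) (x : C) :
  parts_gf q N.+1 j x = step q (parts_gf q N) j x.
Proof.
have -> : parts_gf q N.+1 j x = \big[Cplus/RtoC 0]_(s <- [seq lift2 f t |
    f <- [seq f <- small_parts | f.1 + f.2 <= j]%N, t <- parts N (2 - f.2)]) weight q x s
  by [].
rewrite big_allpairs_dep.
under eq_bigr => f _ do under eq_bigr => t _ do rewrite weight_lift2.
under eq_bigr => f _ do rewrite Cbig_scal -/(parts_gf q N (2 - f.2) _).
rewrite /small_parts /step.
have e : (2 - 1 = 1)%N by [].
(* The bound [j] leaves one, three or all five of the pairs in [small_parts]. *)
by case: j => [|[|j]]; rewrite /= ?big_cons big_nil /= ?e ?subnn subn0; ring.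
Qed.

Lemma sum_n_big (F : nat -> C) (n : nat) :
  sum_n F n = \big[Cplus/RtoC 0]_(i < n.+1) F i.
Proof.
elim: n => [|n IH]; first by rewrite sum_O big_ord_recl big_ord0 Cplus_0_r.
by rewrite Csum_S big_ord_recr /= IH.
Qed.

Lemma big_const_count (T : Type) (r : seq T) (P : pred T) (z : C) :
  \big[Cplus/RtoC 0]_(i <- r | P i) z = (RtoC (INR (count P r)) * z)%C.
Proof.
elim: r => [|i r IH]; first by rewrite big_nil /=; ring.
rewrite big_cons IH.
have -> : count P (i :: r) = (P i + count P r)%N by [].
case: (P i); last by rewrite (_ : (false + _)%N = count P r).
by rewrite (_ : (true + _)%N = (count P r).+1) // S_INR RtoC_plus; ring.
Qed.

(** The list [parts K 2] contains every relevant partition of every [n <= K], and the filter removes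
    larger sums. Grouping by sum and then by length gives the coefficients. *)
Lemma lhs_partial_sum (q x : C) (K : nat) :
  sum_n (fun n => lhs_coef x n * Cpow q n)%C K =
  \big[Cplus/RtoC 0]_(s <- parts K 2 | (sumn s <= K)%N) weight q x s.
Proof.
rewrite (partition_big (fun s => inord (sumn s) : 'I_K.+1) xpredT) // sum_n_big.
apply: eq_bigr => n _.
rewrite /lhs_coef sum_n_big Cmult_comm -Cbig_scal.
rewrite (eq_bigl (fun s => sumn s == n)); last first.
  move=> s /=; have hn := ltn_ord n; apply/andP/eqP.
  - by case=> h /eqP <-; rewrite inordK.
  - by move=> e; split; [lia | apply/eqP; apply: val_inj; rewrite /= inordK //; lia].
(* Lengths fit in ['I_n.+1] because positive parts force [size s <= sumn s]. *)
rewrite (partition_big (fun s => inord (size s) : 'I_n.+1) xpredT) //=.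
apply: eq_bigr => l _.
have -> : B l n = count (fun s => (size s == l) && (sumn s == n)) (parts K 2).
  by apply: B_count; have := ltn_ord n; lia.
rewrite (_ : q ^ n * _ = RtoC (INR (count (fun s => (size s == l) && (sumn s == n))
   (parts K 2))) * (x ^ l * q ^ n))%C; last by ring.
rewrite -big_const_count [LHS]big_seq_cond [RHS]big_seq_cond; apply: eq_big => [s|s].
- case: (boolP (s \in parts K 2)) => //= /mem_parts[[s0 _ _ _ _] _].
  have h1 := size_le_sumn s s0; have hl := ltn_ord l.
  apply/andP/andP; case=> /eqP h2 /eqP h3; split; apply/eqP => //.
  - by apply: val_inj; rewrite /= inordK //; lia.
  - by rewrite -h3 inordK //; lia.
- by case/andP => _ /andP[/eqP <- /eqP <-].
Qed.

(** * Passing to the limit *)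

Lemma Cmod_big_le (T : Type) (r : seq T) (P : pred T) (F : T -> C) :
  Cmod (\big[Cplus/RtoC 0]_(i <- r | P i) F i) <=
  \big[Rplus/0]_(i <- r | P i) Cmod (F i).
Proof.
apply: (big_ind2 (fun z u => Cmod z <= u)) => [|z1 r1 z2 r2 h1 h2|i _].
- by rewrite Cmod_0; right.
- by apply: Rle_trans (Cmod_triangle _ _) _; apply: Rplus_le_compat.
- by right.
Qed.

Lemma Rbig_ge0 (T : Type) (r : seq T) (P : pred T) (F : T -> R) :
  (forall i, 0 <= F i) -> 0 <= \big[Rplus/0]_(i <- r | P i) F i.
Proof.
move=> hF; elim/big_ind: _ => // [|x y hx hy]; first by right.
exact: Rplus_le_le_0_compat.
Qed.

Lemma Rbig_sub_le (T : eqType) (r1 r2 : seq T) (F : T -> R) :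
  (forall i, 0 <= F i) -> uniq r1 -> uniq r2 -> {subset r1 <= r2} ->
  \big[Rplus/0]_(i <- r1) F i <= \big[Rplus/0]_(i <- r2) F i.
Proof.
move=> hF u1 u2 h; rewrite [X in _ <= X](bigID (fun i => i \in r1)) /=.
have -> : \big[Rplus/0]_(i <- r2 | i \in r1) F i = \big[Rplus/0]_(i <- r1) F i.
  rewrite -big_filter; apply: perm_big; apply: uniq_perm => //.
  - exact: filter_uniq.
  - by move=> i; rewrite mem_filter; case: (boolP (i \in r1)) => //= /h.
rewrite -[X in X <= _]Rplus_0_r; apply: Rplus_le_compat_l; exact: Rbig_ge0.
Qed.

Lemma parts_gf_abs (q x : C) (N j : nat) :
  parts_gf (RtoC (Cmod q)) N j (RtoC (Cmod x)) =
  RtoC (\big[Rplus/0]_(s <- parts N j) rweight q x s).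
Proof.
rewrite /parts_gf (big_morph RtoC RtoC_plus (erefl _)).
by apply: eq_bigr => s _; rewrite /weight /rweight RtoC_mult !RtoC_pow.
Qed.

Lemma Clim_bounded (u : nat -> C) (l : C) : Clim u l ->
  exists M, forall n, Cmod (u n) <= M.
Proof.
move=> /filterlim_Clim H.
have [M hM] := @filterlim_bounded _ C_NormedModule u (ex_intro _ l H).
by exists M.
Qed.

(** Two exhaustions of the same set of partitions are compared: by largest part ([RP]) and also by
    sum ([RA]). For absolute weights, [RA] increases to some [L] and [RP] never exceeds [L], so the
    discarded weight is at most [L - RA K], which tends to 0. *)
Lemma partial_sums_lim (q x : C) : Cmod q < 1 ->
  Clim (sum_n (fun n => lhs_coef x n * Cpow q n)%C) (Hgf q 2 x).
Proof.
move=> hq.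
pose RP K := \big[Rplus/0]_(s <- parts K 2) rweight q x s.
pose RA K := \big[Rplus/0]_(s <- parts K 2 | (sumn s <= K)%N) rweight q x s.
have hw s := rweight_ge0 q x s.
have hsplit K : RP K = RA K + \big[Rplus/0]_(s <- parts K 2 | ~~ (sumn s <= K)%N) rweight q x s.
  exact: bigID.
have hAP K : RA K <= RP K.
  by rewrite hsplit -[X in X <= _]Rplus_0_r; apply: Rplus_le_compat_l; apply: Rbig_ge0.
have RAle (l : seq (seq nat)) K : uniq l ->
    {subset l <= [seq s <- parts K 2 | (sumn s <= K)%N]} ->
    \big[Rplus/0]_(s <- l) rweight q x s <= RA K.
  move=> ul hl; rewrite /RA -[X in _ <= X]big_filter; apply: Rbig_sub_le => //.
  by apply: filter_uniq; apply: uniq_parts.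
have hmono K K' : (K <= K')%N -> {subset parts K 2 <= parts K' 2}.
  move=> hK s /mem_parts[h1 h2]; apply/mem_parts; split=> //.
  by move: h2; apply: sub_all => p /=; lia.
(* The convergence of the iteration at [|q|] and [|x|] bounds the sums of absolute weights. *)
have [M hM] : exists M, forall K, RP K <= M.
  have hq' : Cmod (RtoC (Cmod q)) < 1 by rewrite Cmod_R Rabs_pos_eq //; apply: Cmod_ge_0.
  have [M hM] := Clim_bounded _ _ (iterate_step_lim _ (parts_gf (RtoC (Cmod q))) 2
    (RtoC (Cmod x)) hq' (parts_gf0 _) (parts_gfS _)).
  exists M => K; apply: Rle_trans (hM K).
  by rewrite parts_gf_abs Cmod_R; apply: Rle_abs.
have hinc K : RA K <= RA K.+1.
  rewrite {1}/RA -big_filter; apply: RAle; first by apply: filter_uniq; apply: uniq_parts.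
  move=> s; rewrite !mem_filter => /andP[h1 /(hmono _ _ (leqnSn K)) ->]; lia.
have [L hL] : ex_finite_lim_seq RA.
  by apply: (ex_finite_lim_seq_incr _ M) => // K; apply: Rle_trans (hAP K) (hM K).
have hAL K : RA K <= L by apply: is_lim_seq_incr_compare.
have hPL K : RP K <= L.
  (* Large enough for no member of the finite list [parts K 2] to be cut off by its sum. *)
  pose K' := (K + \max_(s <- parts K 2) sumn s)%N.
  apply: Rle_trans (hAL K'); apply: RAle; first exact: uniq_parts.
  move=> s hs; rewrite mem_filter (hmono K K' _ s hs) ?andbT; last exact: leq_addr.
  by apply: leq_trans (leq_addl _ _); apply: leq_bigmax_seq.
have htail : is_lim_seq (fun K => L - RA K) 0.
  rewrite -(Rminus_diag L); apply: is_lim_seq_minus' => //; exact: is_lim_seq_const.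
have hP := iterate_step_lim q (parts_gf q) 2 x hq (parts_gf0 q) (parts_gfS q).
apply: (Clim_le _ _ (fun K => (L - RA K) + Cmod (parts_gf q K 2 x - Hgf q 2 x))).
  move=> K; rewrite lhs_partial_sum; set A := \big[_/_]_(_ <- _ | _) _.
  have -> : (A - Hgf q 2 x = - (parts_gf q K 2 x - A) + (parts_gf q K 2 x - Hgf q 2 x))%C
    by ring.
  apply: Rle_trans (Cmod_triangle _ _) _; apply: Rplus_le_compat_r.
  rewrite Cmod_opp /parts_gf (bigID (fun s => (sumn s <= K)%N)) /= -/A.
  set T := \big[_/_]_(_ <- _ | _) _.
  have -> : (A + T - A = T)%C by ring.
  apply: Rle_trans (Cmod_big_le _ _ _ _) _.
  rewrite (eq_bigr (rweight q x)) => [|s _]; last exact: Cmod_weight.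
  by have := hPL K; rewrite hsplit; lra.
by have := is_lim_seq_plus' _ _ _ _ htail hP; rewrite Rplus_0_l.
Qed.

Theorem theorem1p6 (x q : C) (hq : (Cmod q < 1)%R) :
  exists S : C,
    is_series (fun n => (lhs_coef x n * Cpow q n)%C) S /\
    is_series (fun N1 => sum_n (fun N2 => rhs_term x q N1 N2) N1) S.
Proof.
exists (Hgf q 2 x); split; first by apply/is_series_Clim; apply: partial_sums_lim.
(* [Hgf q 2 x] unfolds to S(0,0,0), whose layers are the inner sums over [N2], with N_1 = M + k. *)
apply/is_series_Clim; apply: Clim_ext (SsumP q 0 0 0 x hq) => n.
apply: Csum_ext => N _; apply: Csum_ext => M hM.
rewrite /summand /rhs_term.
have -> : (M + (N - M) = N)%coq_nat by lia.
by rewrite !Nat.mul_0_l !Nat.add_0_r.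
Qed.
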